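(* Let $I=(0,1)$, $\nu>0$, $\gamma>1$, and let $\rho_0\in C(\bar I)$ with $\rho_0>0$ in $I$, $\rho_0=0$ on $\partial I$, and $u_0$ continuous on $\bar I$. Suppose $(\rho_0,u_0)$ satisfy one of the two conditions: there exist positive $\lambda_1,\lambda_2,\lambda_3,\lambda_4$ with $0<\lambda_3,\lambda_4<1$ such that either ($\frac{(\rho_0)_x}{\rho_0}\ge\lambda_1$ in $(0,\lambda_3)$, $u_0(\lambda_3)<0$, $u_0\le0$ in $(0,\lambda_3)$) or ($\frac{(\rho_0)_x}{\rho_0}\le-\lambda_2$ in $(\lambda_4,1)$, $u_0(\lambda_4)>0$, $u_0\ge0$ in $(\lambda_4,1)$). Then for every $T>0$ the initial-boundary value problem $$\rho_t+(\rho u)_x=0,\quad (\rho u)_t+(\rho u^2+\rho^\gamma)_x=\nu u_{xx}\ \text{ in } I\times(0,T],$$ $$(\rho,u)=(\rho_0,u_0)\text{ on } I\times\{t=0\},\qquad \rho=u=u_x=0\text{ on }\partial I\times(0,T],$$ has no solution $(\rho,u)$ in $C^{2,1}(\bar I\times[0,T])$.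
   Context: $C^{2,1}(\bar I\times[0,T])$ denotes functions that are $C^2$ in $x$ and $C^1$ in $t$ on $\bar I\times[0,T]$. *)

(* Defs.v *)
From Stdlib Require Import Reals.
Open Scope R_scope.

Definition deriv_within (f : R -> R) (a b x l : R) : Prop :=
  limit1_in (fun y => (f y - f x) / (y - x))
            (fun y => a <= y <= b /\ y <> x) l x.

Definition cont_within (f : R -> R) (a b x : R) : Prop :=
  limit1_in f (fun y => a <= y <= b) (f x) x.

Definition in_rect (T x t : R) : Prop := 0 <= x <= 1 /\ 0 <= t <= T.

Definition cont_rect (T : R) (g : R -> R -> R) : Prop :=
  forall x t, in_rect T x t ->
    forall eps, 0 < eps -> exists delta, 0 < delta /\
      forall y s, in_rect T y s -> Rabs (y - x) < delta -> Rabs (s - t) < delta ->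
        Rabs (g y s - g x t) < eps.

Definition C21 (T : R) (f fx fxx ft : R -> R -> R) : Prop :=
  cont_rect T f /\ cont_rect T fx /\ cont_rect T fxx /\ cont_rect T ft /\
  forall x t, in_rect T x t ->
    deriv_within (fun y => f y t) 0 1 x (fx x t) /\
    deriv_within (fun y => fx y t) 0 1 x (fxx x t) /\
    deriv_within (fun s => f x s) 0 T t (ft x t).

(* The pressure power p^gamma; for p <= 0 we use the convention 0^gamma = 0
   (gamma > 0), extended by 0 to p < 0. *)
Definition rpow (p g : R) : R := if Rlt_dec 0 p then Rpower p g else 0.

(* Main.v *)
(** With a vacuum at the boundary, the density is nonincreasing or nondecreasing near
    the endpoint in question for a short time, because the continuity equation
    propagates a lower bound on [rhox / rho].  Hence, after reflection to the left
    endpoint, the pressure gradient is nonnegative there and [u] is a subsolution of a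
    degenerate parabolic equation with [u < 0] at an interior point.  A Hopf-type
    barrier, insensitive to the degeneracy [rho = 0], then forces [ux 0 t < 0] at some
    positive time, against the boundary condition [ux = 0]. *)

Require Import Defs.
From Stdlib Require Import Reals Lra List Classical ClassicalEpsilon.
From Coquelicot Require Import Coquelicot.
Open Scope R_scope.

(** The logarithmic slope condition is carried in integrated form, as monotonicity of
    [exp (- mu * x) * rho]. Working with [rhox / rho] itself would call for exchanging x and t
    derivatives and for strict positivity of the density at later times. Comparing the values at two
    points [x <= y] uses first derivatives of [rho] only and tolerates zeros. The barrier does not
    feel the degeneracy because [rho] multiplies only first derivatives of [u], of first order in
    the steepness [k] of the barrier, while diffusion has the constant factor [nu] and is of second
    order: a large [k] wins for every value of [rho] in a bounded nonnegative range. Nonnegativity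
    of [rho] is not assumed of the solution, so it gets a minimum principle of its own. *)

(** * Extrema of continuous functions on compact sets *)

Lemma list_argmin (A : Type) (f : A -> R) (l : list A) (a0 : A) :
  exists a, In a (a0 :: l) /\ forall b, In b (a0 :: l) -> f a <= f b.
Proof.
  induction l as [|c l IH] in a0 |- *.
  - exists a0; split; [now left|]. intros b [<-|[]]; lra.
  - destruct (IH c) as [a [Ha Hmin]].
    destruct (Rle_dec (f a0) (f a)) as [H|H].
    + exists a0; split; [now left|]. intros b [<-|Hb]; [lra|].
      specialize (Hmin b Hb); lra.
    + exists a; split; [now right|]. intros b [<-|Hb]; [lra|auto].
Qed.

(** Two space variables and one time variable, as the two-point comparison of densities requires;
    one-point arguments repeat the same [x] in both slots. *)
Definition in_box (a b : R) (T : R) (p : R * R * R) : Prop :=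
  a <= fst (fst p) <= b /\ a <= snd (fst p) <= b /\ 0 <= snd p <= T.

(** The constraint [0 <= g] cuts curved or triangular domains out of the box; [g = 0] leaves the
    whole box. Without a minimizer, every admissible point has a ball whose admissible points are
    all beaten strictly by one fixed admissible point, and every inadmissible point of the box has a
    ball free of admissible points. The best of the finitely many beating points of a subcover would
    then be beaten itself. *)
Lemma continuous_min_attained (a b T : R) (f g : R * R * R -> R) (p0 : R * R * R)
  (Hf : forall p, continuous f p) (Hg : forall p, continuous g p)
  (Hp0 : in_box a b T p0) (Hgp0 : 0 <= g p0) :
  exists p, in_box a b T p /\ 0 <= g p /\
    forall q, in_box a b T q -> 0 <= g q -> f p <= f q.
Proof.
  apply NNPP; intros Hno.
  assert (Hstep : forall p, exists dq : posreal * (R * R * R), in_box a b T p ->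
     (in_box a b T (snd dq) /\ 0 <= g (snd dq)) /\
     forall r, ball p (fst dq) r -> 0 <= g r -> f (snd dq) < f r).
  { intros p.
    destruct (classic (in_box a b T p)) as [Hp|Hp];
      [|exists (mkposreal 1 Rlt_0_1, p0); tauto].
    destruct (Rle_dec 0 (g p)) as [Hgp|Hgp].
    - assert (exists q, in_box a b T q /\ 0 <= g q /\ f q < f p) as [q [Hq [Hgq Hfq]]].
      { apply NNPP; intros H; apply Hno; exists p; split; [|split]; auto.
        intros q Hq Hgq. apply Rnot_lt_le; intros Hlt; apply H; eauto. }
      assert (He : 0 < f p - f q) by lra.
      destruct (proj1 (filterlim_locally _ _) (Hf p) (mkposreal _ He)) as [d Hd].
      exists (d, q); intros _; split; [tauto|]. intros r Hr _.
      specialize (Hd r Hr). apply Rabs_def2 in Hd; simpl in *.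
      unfold minus, plus, opp in Hd; simpl in Hd; lra.
    - assert (He : 0 < - g p) by lra.
      destruct (proj1 (filterlim_locally _ _) (Hg p) (mkposreal _ He)) as [d Hd].
      exists (d, p0); intros _; split; [tauto|]. intros r Hr Hgr.
      specialize (Hd r Hr). apply Rabs_def2 in Hd; simpl in *.
      unfold minus, plus, opp in Hd; simpl in Hd; lra. }
  set (dq := fun p => proj1_sig (constructive_indefinite_description _ (Hstep p))).
  assert (Hdq : forall p, in_box a b T p ->
     (in_box a b T (snd (dq p)) /\ 0 <= g (snd (dq p))) /\
     forall r, ball p (fst (dq p)) r -> 0 <= g r -> f (snd (dq p)) < f r).
  { intros p; unfold dq; apply proj2_sig. }
  clearbody dq.
  set (pt := fun v : Compactness.Tn 3 R => (fst v, fst (snd v), fst (snd (snd v)))).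
  apply (compactness_list 3 (a, (a, (0, tt))) (b, (b, (T, tt)))
           (fun v => fst (dq (pt v)))).
  intros [l Hl].
  assert (Hl' : forall q, in_box a b T q -> 0 <= g q -> exists v, In v l /\
     in_box a b T (pt v) /\ f (snd (dq (pt v))) < f q).
  { intros [[x y] t] [H1 [H2 H3]] Hgq; simpl in *.
    destruct (Hl (x, (y, (t, tt)))) as [[x' [y' [t' []]]] [Hin [Hb Hc]]];
      [simpl; tauto|].
    simpl in Hb, Hc. exists (x', (y', (t', tt))).
    assert (in_box a b T (pt (x', (y', (t', tt))))) as Hbox
      by (unfold in_box, pt; simpl; tauto).
    split; [assumption|split; [assumption|]].
    apply (proj2 (Hdq _ Hbox)); [|assumption].
    split; [split|]; unfold pt; simpl; apply Hc. }
  destruct (Hl' p0 Hp0 Hgp0) as [v0 [Hv0 [Hbv0 _]]].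
  (* The cover may list centres outside the box, where [dq] says nothing. They receive the value of
     the genuine centre [v0], so the minimum over the list is still the value at an admissible
     point. *)
  set (F := fun v => if excluded_middle_informative (in_box a b T (pt v))
                     then f (snd (dq (pt v))) else f (snd (dq (pt v0)))).
  destruct (list_argmin _ F l v0) as [v [Hv Hmin]].
  assert (exists w, in_box a b T (pt w) /\ F v = f (snd (dq (pt w)))) as [w [Hw HF]].
  { unfold F; destruct (excluded_middle_informative (in_box a b T (pt v))); eauto. }
  destruct (Hdq _ Hw) as [[Hq Hgq] _].
  destruct (Hl' _ Hq Hgq) as [v1 [Hv1 [Hb1 Hlt]]].
  specialize (Hmin v1 (or_intror Hv1)). rewrite HF in Hmin.
  unfold F in Hmin; destruct (excluded_middle_informative (in_box a b T (pt v1)));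
    [lra|tauto].
Qed.

Lemma continuous_max_attained (a b T : R) (f : R * R * R -> R)
  (Hf : forall p, continuous f p) (Hab : a <= b) (HT : 0 <= T) :
  exists p, in_box a b T p /\ forall q, in_box a b T q -> f q <= f p.
Proof.
  destruct (continuous_min_attained a b T (fun p => - f p) (fun _ => 0) ((a, a), 0))
    as [p [Hp [_ Hmin]]].
  - intros p; apply (continuous_opp (V := R_NormedModule)), Hf.
  - intros p; apply continuous_const.
  - unfold in_box; simpl; lra.
  - lra.
  - exists p; split; [assumption|]. intros q Hq.
    specialize (Hmin q Hq (Rle_refl 0)); lra.
Qed.

Definition clamp (c x : R) : R := Rmax 0 (Rmin c x).

Lemma clamp_id (c x : R) : 0 <= x <= c -> clamp c x = x.
Proof. unfold clamp, Rmax, Rmin; repeat destruct Rle_dec; lra. Qed.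

Lemma clamp_range (c x : R) : 0 <= c -> 0 <= clamp c x <= c.
Proof. unfold clamp, Rmax, Rmin; repeat destruct Rle_dec; lra. Qed.

Lemma clamp_lipschitz (c x y : R) : Rabs (clamp c x - clamp c y) <= Rabs (x - y).
Proof.
  unfold clamp, Rmax, Rmin; repeat destruct Rle_dec; unfold Rabs; repeat destruct Rcase_abs; lra.
Qed.

(** Projecting each coordinate onto its interval is 1-Lipschitz, so composing with it keeps the
    modulus of continuity and yields continuity at every point of the plane, the form in which the
    extremum lemmas take it. *)
Lemma cont_rect_extend (T : R) (g : R -> R -> R) : 0 <= T -> cont_rect T g ->
  exists G : R -> R -> R, (forall q : R * R, continuous (fun p => G (fst p) (snd p)) q) /\
    forall x t, in_rect T x t -> G x t = g x t.
Proof.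
  intros HT Hg. exists (fun x t => g (clamp 1 x) (clamp T t)); split.
  - intros [x t]. apply filterlim_locally; intros eps.
    destruct (Hg (clamp 1 x) (clamp T t)) with (eps := pos eps) as [d [Hd Hc]].
    { split; apply clamp_range; lra. }
    { apply cond_pos. }
    exists (mkposreal d Hd). intros [y s] [H1 H2]; simpl in *.
    apply Hc; [split; apply clamp_range; lra| |];
      eapply Rle_lt_trans; try apply clamp_lipschitz; [apply H1|apply H2].
  - intros x t [Hx Ht]. now rewrite !clamp_id.
Qed.

Lemma cont_rect_bounded (T : R) (g : R -> R -> R) : 0 <= T -> cont_rect T g ->
  exists M, 0 <= M /\ forall x t, in_rect T x t -> Rabs (g x t) <= M.
Proof.
  intros HT Hg. destruct (cont_rect_extend T g HT Hg) as [G [HG HGg]].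
  destruct (continuous_max_attained 0 1 T
              (fun p => Rabs (G (fst (fst p)) (snd p)))) as [p [Hp Hmax]]; try lra.
  - intros p. apply continuous_comp; [|apply continuous_Rabs].
    apply continuous_comp_2; [| |apply HG].
    + apply continuous_comp; destruct p as [[x y] t]; apply continuous_fst.
    + destruct p as [[x y] t]; apply continuous_snd.
  - exists (Rabs (G (fst (fst p)) (snd p))); split; [apply Rabs_pos|].
    intros x t Hxt. rewrite <- HGg by assumption.
    apply (Hmax ((x, x), t)). destruct Hxt; split; [|split]; assumption.
Qed.

(** * One-variable derivative tests at extrema *)

Lemma is_derive_left_min (f : R -> R) (a c l : R) : is_derive f c l -> a < c ->
  (forall x, a < x < c -> f c <= f x) -> l <= 0.
Proof.
  intros Hd Hac Hmin. apply Rnot_lt_le; intros Hl.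
  apply is_derive_Reals in Hd. destruct (Hd l Hl) as [d Hd'].
  set (h := Rmin (d / 2) ((c - a) / 2)).
  assert (Hh : 0 < h /\ h <= d / 2 /\ h <= (c - a) / 2).
  { unfold h; split; [|split; [apply Rmin_l|apply Rmin_r]].
    apply Rmin_pos; [|lra]. pose proof (cond_pos d); lra. }
  pose proof (cond_pos d). specialize (Hd' (- h)).
  assert (Hlt : Rabs ((f (c + - h) - f c) / - h - l) < l).
  { apply Hd'; [lra|]. rewrite Rabs_Ropp, Rabs_pos_eq; lra. }
  apply Rabs_def2 in Hlt.
  assert (f c <= f (c + - h)) by (apply Hmin; lra).
  assert (Hq : (f (c + - h) - f c) / - h = - ((f (c + - h) - f c) / h)) by (field; lra).
  assert (0 <= (f (c + - h) - f c) / h) by (apply Rdiv_le_0_compat; lra).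
  lra.
Qed.

Lemma is_derive_right_min (f : R -> R) (c b l : R) : is_derive f c l -> c < b ->
  (forall x, c < x < b -> f c <= f x) -> 0 <= l.
Proof.
  intros Hd Hcb Hmin.
  assert (Hr : is_derive (fun x => f (- x)) (- c) (- l)).
  { replace (- l) with (scal (-1) l) by (unfold scal; simpl; unfold mult; simpl; ring).
    apply (is_derive_comp f Ropp).
    - now rewrite Ropp_involutive.
    - auto_derive; [trivial|ring]. }
  enough (- l <= 0) by lra.
  apply (is_derive_left_min (fun x => f (- x)) (- b) (- c)); [assumption|lra|].
  intros x Hx; rewrite Ropp_involutive; apply Hmin; lra.
Qed.

Lemma is_derive_interior_min (f : R -> R) (a b c l : R) : is_derive f c l ->
  a < c < b -> (forall x, a < x < b -> f c <= f x) -> l = 0.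
Proof.
  intros Hd Hc Hmin. apply Rle_antisym.
  - apply (is_derive_left_min f a c); auto; [lra|]. intros; apply Hmin; lra.
  - apply (is_derive_right_min f c b); auto; [lra|]. intros; apply Hmin; lra.
Qed.

(** The second derivative is known at [c] alone. As [f' c = 0], a positive [l] makes [f'] positive
    just to the right of [c], and the mean value theorem lifts [f] above its maximum. *)
Lemma is_derive_interior_max2 (f f' : R -> R) (a b c l : R) :
  (forall x, a < x < b -> is_derive f x (f' x)) -> is_derive f' c l ->
  a < c < b -> (forall x, a < x < b -> f x <= f c) -> l <= 0.
Proof.
  intros Hf Hf' Hc Hmax.
  assert (H0 : f' c = 0).
  { enough (- f' c = 0) by lra.
    apply (is_derive_interior_min (fun x => - f x) a b c); auto.
    - apply (is_derive_opp (V := R_NormedModule)), Hf, Hc.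
    - intros x Hx; apply Ropp_le_contravar, Hmax, Hx. }
  apply Rnot_lt_le; intros Hl.
  apply is_derive_Reals in Hf'. destruct (Hf' l Hl) as [d Hd].
  set (h := Rmin (d / 2) ((b - c) / 2)).
  assert (Hh : 0 < h /\ h <= d / 2 /\ h <= (b - c) / 2).
  { unfold h; split; [|split; [apply Rmin_l|apply Rmin_r]].
    apply Rmin_pos; [|lra]. pose proof (cond_pos d); lra. }
  pose proof (cond_pos d).
  assert (Hpos : forall x, c < x <= c + h -> 0 < f' x).
  { intros x Hx. specialize (Hd (x - c)).
    replace (c + (x - c)) with x in Hd by ring.
    assert (Hlt : Rabs ((f' x - f' c) / (x - c) - l) < l).
    { apply Hd; [lra|]. rewrite Rabs_pos_eq; lra. }
    apply Rabs_def2 in Hlt. rewrite H0, Rminus_0_r in Hlt.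
    replace (f' x) with (f' x / (x - c) * (x - c)) by (field; lra).
    apply Rmult_lt_0_compat; lra. }
  assert (c <= c + h) by lra.
  destruct (MVT_cor2 f f' c (c + h)) as [z [Hz1 Hz2]]; [lra| |].
  - intros z Hz; apply is_derive_Reals, Hf; lra.
  - assert (0 < f' z) by (apply Hpos; lra).
    assert (f (c + h) <= f c) by (apply Hmax; lra). nra.
Qed.

Lemma is_derive_ge0_le (f : R -> R) (x y : R) : x <= y ->
  (forall z, x <= z <= y -> exists d, is_derive f z d /\ 0 <= d) -> f x <= f y.
Proof.
  intros [Hxy|<-] Hf; [|lra].
  destruct (MVT_cor2 f (Derive f) x y) as [z [Hz1 Hz2]]; [assumption| |].
  - intros z Hz. destruct (Hf z Hz) as [d [Hd _]].
    apply is_derive_Reals. now rewrite (is_derive_unique _ _ _ Hd).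
  - destruct (Hf z) as [d [Hd Hd0]]; [lra|].
    rewrite (is_derive_unique _ _ _ Hd) in Hz1. nra.
Qed.

Lemma deriv_within_interior (f : R -> R) (a b x l : R) : a < x < b ->
  deriv_within f a b x l -> is_derive f x l.
Proof.
  intros Hx Hd. apply is_derive_Reals. intros eps Heps.
  destruct (Hd eps Heps) as [alp [Halp Hlim]].
  assert (H0 : 0 < Rmin alp (Rmin (x - a) (b - x))) by (repeat apply Rmin_pos; lra).
  exists (mkposreal _ H0). intros h Hh Hlt; simpl in Hlt.
  assert (Rabs h < alp /\ Rabs h < x - a /\ Rabs h < b - x) as [H1 [H2 H3]].
  { revert Hlt; unfold Rmin; repeat destruct Rle_dec; lra. }
  apply Rabs_def2 in H2; apply Rabs_def2 in H3.
  specialize (Hlim (x + h)). replace (x + h - x) with h in Hlim by ring.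
  apply Hlim; split; [split; lra|].
  simpl; unfold Rdist. now replace (x + h - x) with h by ring.
Qed.

(** Boundary data are prescribed for positive times only; this carries them to the corners at
    [t = 0]. *)
Lemma cont_rect_time_limit (T : R) (g : R -> R -> R) (x c : R) : 0 < T -> 0 <= x <= 1 ->
  cont_rect T g -> (forall t, 0 < t <= T -> g x t = c) -> g x 0 = c.
Proof.
  intros HT Hx Hg Hc. apply NNPP; intros Hne.
  assert (Heps : 0 < Rabs (c - g x 0)) by (apply Rabs_pos_lt; lra).
  destruct (Hg x 0) with (eps := Rabs (c - g x 0)) as [d [Hd Hcont]];
    [split; lra|assumption|].
  assert (H0 : 0 < Rmin (d / 2) T <= T /\ Rmin (d / 2) T < d).
  { split; [split; [apply Rmin_pos; lra|apply Rmin_r]|].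
    apply Rle_lt_trans with (d / 2); [apply Rmin_l|lra]. }
  specialize (Hcont x (Rmin (d / 2) T)).
  rewrite Hc in Hcont by lra.
  apply (Rlt_irrefl (Rabs (c - g x 0))), Hcont.
  - split; lra.
  - unfold Rminus; rewrite Rplus_opp_r, Rabs_R0; assumption.
  - rewrite Rminus_0_r, Rabs_pos_eq; lra.
Qed.

Lemma rpow_le (g p q : R) : 0 < g -> p <= q -> rpow p g <= rpow q g.
Proof.
  intros Hg Hpq. unfold rpow. destruct (Rlt_dec 0 p), (Rlt_dec 0 q); try lra.
  - apply Rle_Rpower_l; lra.
  - apply Rlt_le, exp_pos.
Qed.

(** The form of the problem on which the maximum principles act, chosen to be stable under
    reflection. Momentum is in nonconservative form, times are interior so that derivatives are
    two-sided, and the pressure gradient is an unspecified [px], of which only the sign will matter.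
    The boundary slope is kept as a one-sided difference quotient, ready to be compared with the
    barrier. *)
Record gas_flow (nu gamma T : R) (rho rhox rhot u ux uxx ut : R -> R -> R) : Prop := {
  gf_rho : cont_rect T rho;
  gf_u : cont_rect T u;
  gf_ux : cont_rect T ux;
  gf_uxx : cont_rect T uxx;
  gf_rho_x : forall x t, 0 < x < 1 -> 0 < t < T -> is_derive (fun y => rho y t) x (rhox x t);
  gf_rho_t : forall x t, 0 < x < 1 -> 0 < t < T -> is_derive (fun s => rho x s) t (rhot x t);
  gf_u_x : forall x t, 0 < x < 1 -> 0 < t < T -> is_derive (fun y => u y t) x (ux x t);
  gf_u_t : forall x t, 0 < x < 1 -> 0 < t < T -> is_derive (fun s => u x s) t (ut x t);
  gf_ux_x : forall x t, 0 < x < 1 -> 0 < t < T -> is_derive (fun y => ux y t) x (uxx x t);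
  gf_mass : forall x t, 0 < x < 1 -> 0 < t < T ->
    rhot x t + (rhox x t * u x t + rho x t * ux x t) = 0;
  gf_momentum : forall x t, 0 < x < 1 -> 0 < t < T ->
    exists px, is_derive (fun y => rpow (rho y t) gamma) x px /\
      rho x t * (ut x t + u x t * ux x t) + px = nu * uxx x t;
  gf_rho_init : forall x, 0 < x < 1 -> 0 <= rho x 0;
  gf_bd : forall t, 0 <= t <= T ->
    rho 0 t = 0 /\ rho 1 t = 0 /\ u 0 t = 0 /\ u 1 t = 0;
  gf_slope : forall t, 0 < t < T ->
    deriv_within (fun y => u y t) 0 1 0 0 /\ deriv_within (fun y => u y t) 0 1 1 0
}.

Arguments gf_rho {nu gamma T rho rhox rhot u ux uxx ut}.
Arguments gf_u {nu gamma T rho rhox rhot u ux uxx ut}.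
Arguments gf_ux {nu gamma T rho rhox rhot u ux uxx ut}.
Arguments gf_uxx {nu gamma T rho rhox rhot u ux uxx ut}.
Arguments gf_rho_x {nu gamma T rho rhox rhot u ux uxx ut}.
Arguments gf_rho_t {nu gamma T rho rhox rhot u ux uxx ut}.
Arguments gf_u_x {nu gamma T rho rhox rhot u ux uxx ut}.
Arguments gf_u_t {nu gamma T rho rhox rhot u ux uxx ut}.
Arguments gf_ux_x {nu gamma T rho rhox rhot u ux uxx ut}.
Arguments gf_mass {nu gamma T rho rhox rhot u ux uxx ut}.
Arguments gf_momentum {nu gamma T rho rhox rhot u ux uxx ut}.
Arguments gf_rho_init {nu gamma T rho rhox rhot u ux uxx ut}.
Arguments gf_bd {nu gamma T rho rhox rhot u ux uxx ut}.
Arguments gf_slope {nu gamma T rho rhox rhot u ux uxx ut}.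


Lemma continuous_fst_fst (p : R * R * R) : continuous (fun q : R * R * R => fst (fst q)) p.
Proof. apply continuous_comp; destruct p as [[x y] t]; apply continuous_fst. Qed.

Lemma continuous_snd_fst (p : R * R * R) : continuous (fun q : R * R * R => snd (fst q)) p.
Proof.
  destruct p as [[x y] t]. apply continuous_comp; [apply continuous_fst|apply continuous_snd].
Qed.

Lemma continuous_snd_3 (p : R * R * R) : continuous (fun q : R * R * R => snd q) p.
Proof. destruct p as [[x y] t]; apply continuous_snd. Qed.

Lemma continuous_Rmin (U : UniformSpace) (f g : U -> R) (x : U) :
  continuous f x -> continuous g x -> continuous (fun y => Rmin (f y) (g y)) x.
Proof.
  intros Hf Hg.
  apply continuous_ext with (fun y => (f y + g y - Rabs (f y - g y)) * / 2).
  { intros y. unfold Rmin, Rabs. destruct Rle_dec, Rcase_abs; lra. }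
  apply (continuous_mult (K := R_AbsRing)); [|apply continuous_const].
  apply (continuous_minus (V := R_NormedModule)).
  - now apply (continuous_plus (V := R_NormedModule)).
  - apply continuous_comp; [|apply continuous_Rabs].
    now apply (continuous_minus (V := R_NormedModule)).
Qed.

Lemma is_derive_exp_mult (a h : R -> R) (t a' l : R) : is_derive a t a' -> is_derive h t l ->
  is_derive (fun s => exp (a s) * h s) t (exp (a t) * (l + a' * h t)).
Proof.
  intros Ha Hh. auto_derive.
  - repeat split; [now exists a'|now exists l].
  - replace (Derive (fun x => a x) t) with a' by (symmetry; now apply is_derive_unique).
    replace (Derive (fun x => h x) t) with l by (symmetry; now apply is_derive_unique).
    ring.
Qed.

Ltac solve_continuous :=
  lazymatch goal with
  | |- continuous (fun _ => ?c) _ => apply continuous_const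
  | |- continuous (fun q => fst (fst q)) _ => apply continuous_fst_fst
  | |- continuous (fun q => snd (fst q)) _ => apply continuous_snd_fst
  | |- continuous (fun q => snd q) _ => apply continuous_snd_3
  | |- continuous (fun q => Rmin (@?f q) (@?g q)) _ =>
      apply (continuous_Rmin _ f g); solve_continuous
  | |- continuous (fun q => exp (@?f q)) _ =>
      apply (continuous_comp f exp); [solve_continuous|apply continuous_exp]
  | |- continuous (fun q => @?f q + @?g q) _ =>
      apply (continuous_plus (V := R_NormedModule) f g); solve_continuous
  | |- continuous (fun q => @?f q - @?g q) _ =>
      apply (continuous_minus (V := R_NormedModule) f g); solve_continuous
  | |- continuous (fun q => - @?f q) _ =>
      apply (continuous_opp (V := R_NormedModule) f); solve_continuous
  | |- continuous (fun q => @?f q * @?g q) _ =>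
      apply (continuous_mult (K := R_AbsRing) f g); solve_continuous
  | H : forall q, continuous (fun p => ?G (fst p) (snd p)) q
      |- continuous (fun q => ?G (@?f q) (@?g q)) _ =>
      apply (continuous_comp_2 f g G); [solve_continuous|solve_continuous|apply H]
  end.

(** * Sign and monotonicity of the density, and the boundary barrier *)

(** At a negative minimum of [exp (c * t) * rho] the transport term vanishes with [rhox], leaving
    [rhot = - rho * ux], which the exponential factor outweighs. *)
Lemma density_nonneg (nu gamma T : R) (rho rhox rhot u ux uxx ut : R -> R -> R) :
  gas_flow nu gamma T rho rhox rhot u ux uxx ut ->
  forall x t, 0 <= x <= 1 -> 0 <= t < T -> 0 <= rho x t.
Proof.
  intros Hfl x1 t1 Hx1 Ht1. apply Rnot_lt_le; intros Hneg.
  destruct (cont_rect_bounded T ux) as [M [HM Hux]]; [lra|apply Hfl|].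
  destruct (cont_rect_extend T rho) as [G [HG HGr]]; [lra|apply Hfl|].
  (* The minimum conditions will give [rho * (c - ux) <= 0] with [rho < 0], hence [c >= ux >= - M],
     which this choice excludes. *)
  set (c := - (M + 1)).
  destruct (continuous_min_attained 0 1 t1
              (fun p => exp (c * snd p) * G (fst (fst p)) (snd p)) (fun _ => 0)
              ((x1, x1), t1)) as [[[x z] t] [[Hx [_ Ht]] [_ Hmin]]].
  - intros q; solve_continuous.
  - intros q; solve_continuous.
  - split; [|split]; simpl; lra.
  - lra.
  - simpl in Hx, Ht.
    assert (Hmin' : forall y s, 0 <= y <= 1 -> 0 <= s <= t1 ->
              exp (c * t) * rho x t <= exp (c * s) * rho y s).
    { intros y s Hy Hs. specialize (Hmin ((y, y), s)). simpl in Hmin.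
      rewrite !HGr in Hmin by (split; lra).
      apply Hmin; [split; [|split]; simpl; lra|lra]. }
    clear Hmin.
    assert (Hr : rho x t < 0).
    { specialize (Hmin' x1 t1 Hx1 ltac:(lra)).
      pose proof (exp_pos (c * t)); pose proof (exp_pos (c * t1)). nra. }
    destruct (gf_bd Hfl t) as [Hb0 [Hb1 _]]; [lra|].
    assert (Hx' : 0 < x < 1).
    { split; (destruct (Req_dec x 0); [subst; lra|]);
        (destruct (Req_dec x 1); [subst; lra|]); lra. }
    assert (Ht' : 0 < t < T).
    { destruct (Req_dec t 0); [|lra]. subst t.
      pose proof (gf_rho_init Hfl x Hx'). lra. }
    assert (Hrx : rhox x t = 0).
    { apply (is_derive_interior_min (fun y => rho y t) 0 1 x); auto.
      - now apply Hfl.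
      - intros y Hy. specialize (Hmin' y t ltac:(lra) ltac:(lra)).
        apply Rmult_le_reg_l in Hmin'; [assumption|apply exp_pos]. }
    assert (Hrt : exp (c * t) * (rhot x t + c * rho x t) <= 0).
    { apply (is_derive_left_min (fun s => exp (c * s) * rho x s) 0 t); [|lra|].
      - apply is_derive_exp_mult; [auto_derive; [trivial|ring]|now apply Hfl].
      - intros s Hs. apply Hmin'; lra. }
    pose proof (gf_mass Hfl x t Hx' Ht') as Hm.
    specialize (Hux x t ltac:(split; lra)). apply Rabs_le_between in Hux.
    rewrite Hrx in Hm. pose proof (exp_pos (c * t)).
    assert (rhot x t + c * rho x t <= 0) by nra.
    unfold c in *. nra.
Qed.

Arguments density_nonneg {nu gamma T rho rhox rhot u ux uxx ut}.

(* The transport equation for [exp (- mu x) * rho] has zeroth-order coefficient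
   [- ux - mu u - mu' x]; the decay [mu' = - K] of the exponent makes it
   nondecreasing in [x], which propagates monotonicity in [x].  The factor
   [l3 - U t - y] cuts off the part of the domain that can be reached by
   characteristics entering from [x > l3]. *)
Lemma density_monotone (nu gamma T l1 l3 : R) (rho rhox rhot u ux uxx ut : R -> R -> R) :
  gas_flow nu gamma T rho rhox rhot u ux uxx ut -> 0 < T -> 0 < l1 -> 0 < l3 < 1 ->
  (forall x y, 0 < x <= y -> y < l3 ->
     exp (- l1 * x) * rho x 0 <= exp (- l1 * y) * rho y 0) ->
  exists K U, 0 < K /\ 0 < U /\ forall x y t, 0 <= x <= y -> 0 <= t < T ->
    y < l3 - U * t -> K * t <= l1 -> rho x t <= rho y t.
Proof.
  intros Hfl HT Hl1 Hl3 Hinit.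
  destruct (cont_rect_bounded T u) as [M0 [HM0 Hu]]; [lra|apply Hfl|].
  destruct (cont_rect_bounded T ux) as [M1 [HM1 Hux]]; [lra|apply Hfl|].
  destruct (cont_rect_bounded T uxx) as [M2 [HM2 Huxx]]; [lra|apply Hfl|].
  destruct (cont_rect_extend T rho) as [G [HG HGr]]; [lra|apply Hfl|].
  (* [K] makes [- ux - mu * u + K * z] increasing in [z] whenever [0 <= mu <= l1]; [U] exceeds every
     characteristic speed; [c] outweighs the upper bound of that coefficient. *)
  set (K := M2 + l1 * M1 + 1). set (U := M0 + 1).
  set (c := - (M1 + l1 * M0 + K + 1)).
  assert (HK : 0 < K) by (unfold K; nra).
  exists K, U. split; [assumption|split; [unfold U; lra|]].
  intros x1 y1 t1 Hx1 Ht1 Hy1 HKt.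
  assert (HU : 0 < U) by (unfold U; lra).
  assert (HUt : forall s, 0 <= s -> 0 <= U * s) by (intros; nra).
  pose proof (HUt t1 ltac:(lra)) as HUt1.
  set (w := fun x t => exp (- (l1 - K * t) * x) * rho x t).
  assert (Hw0 : w x1 t1 <= w y1 t1).
  (* Dropping the weight: [K * t1 <= l1] makes the exponent rate nonnegative, so the weight at [y1]
     is at most that at [x1], and [rho y1 t1 >= 0]. *)
  2:{ unfold w in Hw0.
      assert (He : exp (- (l1 - K * t1) * y1) <= exp (- (l1 - K * t1) * x1)).
      { destruct (Req_dec ((l1 - K * t1) * y1) ((l1 - K * t1) * x1)) as [Heq|Hne].
        - replace (- (l1 - K * t1) * y1) with (- (l1 - K * t1) * x1) by lra; lra.
        - apply Rlt_le, exp_increasing. nra. }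
      pose proof (density_nonneg Hfl y1 t1 ltac:(lra) ltac:(lra)).
      pose proof (exp_pos (- (l1 - K * t1) * x1)). nra. }
  apply Rnot_lt_le; intros Hneg.
  (* Doubling of variables on [x <= y <= l3 - U * t]. The minimum is negative, so it avoids the
     diagonal and the cutoff line, where the function vanishes, as well as [x = 0] and [t = 0],
     where it is nonnegative. *)
  destruct (continuous_min_attained 0 1 t1
    (fun p => exp (c * snd p) * ((l3 - U * snd p - snd (fst p)) *
       (exp (- (l1 - K * snd p) * snd (fst p)) * G (snd (fst p)) (snd p) -
        exp (- (l1 - K * snd p) * fst (fst p)) * G (fst (fst p)) (snd p))))
    (fun p => Rmin (snd (fst p) - fst (fst p)) (l3 - U * snd p - snd (fst p)))
    ((x1, y1), t1)) as [[[x y] t] [[Hx [Hy Ht]] [Hg Hmin]]].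
  { intros q; solve_continuous. }
  { intros q; solve_continuous. }
  { split; [|split]; simpl; lra. }
  { simpl; apply Rmin_glb; lra. }
  simpl in Hx, Hy, Ht, Hg.
  assert (Hxy : x <= y /\ y <= l3 - U * t).
  { pose proof (Rmin_l (y - x) (l3 - U * t - y)).
    pose proof (Rmin_r (y - x) (l3 - U * t - y)). lra. }
  clear Hg.
  pose proof (HUt t ltac:(lra)) as HUt'.
  assert (Hmin' : forall x' y' s, 0 <= x' <= y' -> 0 <= s <= t1 -> y' <= l3 - U * s ->
    exp (c * t) * ((l3 - U * t - y) * (w y t - w x t)) <=
    exp (c * s) * ((l3 - U * s - y') * (w y' s - w x' s))).
  { intros x' y' s Hx' Hs Hy'. pose proof (HUt s ltac:(lra)).
    specialize (Hmin ((x', y'), s)). simpl in Hmin.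
    rewrite !HGr in Hmin by (split; lra).
    apply Hmin; [split; [|split]; simpl; lra|]. simpl; apply Rmin_glb; lra. }
  clear Hmin.
  assert (Hlt : (l3 - U * t - y) * (w y t - w x t) < 0).
  { specialize (Hmin' x1 y1 t1 Hx1 ltac:(lra) ltac:(lra)).
    pose proof (exp_pos (c * t)); pose proof (exp_pos (c * t1)).
    assert ((l3 - U * t1 - y1) * (w y1 t1 - w x1 t1) < 0) by nra. nra. }
  assert (Hchi : 0 < l3 - U * t - y).
  { destruct (Req_dec (l3 - U * t - y) 0) as [H0|H0]; [rewrite H0 in Hlt; lra|lra]. }
  assert (HZ : w y t - w x t < 0).
  { apply Rnot_le_lt; intros HZ. pose proof (Rmult_le_pos _ _ (Rlt_le _ _ Hchi) HZ). lra. }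
  assert (Hx0 : 0 < x).
  { destruct (Req_dec x 0); [|lra]. subst x.
    destruct (gf_bd Hfl t) as [Hb _]; [lra|].
    unfold w in HZ. rewrite Hb in HZ.
    pose proof (density_nonneg Hfl y t ltac:(lra) ltac:(lra)).
    pose proof (exp_pos (- (l1 - K * t) * y)). nra. }
  assert (Hxy' : x < y).
  { destruct (Req_dec x y); [subst; lra|lra]. }
  assert (Ht0 : 0 < t).
  { destruct (Req_dec t 0); [|lra]. subst t.
    specialize (Hinit x y ltac:(lra) ltac:(lra)).
    unfold w in HZ. rewrite !Rmult_0_r, !Rminus_0_r in HZ. lra. }
  set (mu := l1 - K * t).
  assert (Hmu : 0 <= mu <= l1) by (unfold mu; split; nra).
  assert (Hwx : forall z, 0 < z < 1 ->
    is_derive (fun z => w z t) z (exp (- mu * z) * (rhox z t + - mu * rho z t))).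
  { intros z Hz. apply (is_derive_exp_mult (fun z => - mu * z) (fun z => rho z t)).
    - auto_derive; [trivial|ring].
    - apply Hfl; lra. }
  assert (Hwt : forall z, 0 < z < 1 ->
    is_derive (fun s => w z s) t (exp (- mu * z) * (rhot z t + K * z * rho z t))).
  { intros z Hz. apply (is_derive_exp_mult (fun s => - (l1 - K * s) * z) (fun s => rho z s)).
    - auto_derive; [trivial|ring].
    - apply Hfl; lra. }
  (* Stationarity in [x] removes the transport term at [x], since the cutoff depends on [y] only. *)
  assert (Hdx : exp (- mu * x) * (rhox x t + - mu * rho x t) = 0).
  { enough (- (exp (- mu * x) * (rhox x t + - mu * rho x t)) = 0) by lra.
    apply (is_derive_interior_min (fun z => - w z t) 0 y x); [|lra|].
    - apply (is_derive_opp (V := R_NormedModule)), Hwx; lra.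
    - intros z Hz. specialize (Hmin' z y t ltac:(lra) ltac:(lra) ltac:(lra)).
      apply Rmult_le_reg_l in Hmin'; [|apply exp_pos].
      apply Rmult_le_reg_l in Hmin'; lra. }
  (* Stationarity in [y] trades the cutoff times the slope of [w] at [y] for the difference of [w]
     itself, so the transport term at [y] can be absorbed by the motion of the cutoff. *)
  assert (Hdy : - (w y t - w x t) + (l3 - U * t - y) *
             (exp (- mu * y) * (rhox y t + - mu * rho y t)) = 0).
  { apply (is_derive_interior_min
             (fun z => (l3 - U * t - z) * (w z t - w x t)) x (l3 - U * t) y); [|lra|].
    - assert (Hwy := Hwx y ltac:(lra)). auto_derive.
      + repeat split; eexists; apply Hwy.
      + replace (Derive (fun z => w z t) y) with
          (exp (- mu * y) * (rhox y t + - mu * rho y t))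
          by (symmetry; now apply is_derive_unique). ring.
    - intros z Hz. specialize (Hmin' x z t ltac:(lra) ltac:(lra) ltac:(lra)).
      apply Rmult_le_reg_l in Hmin'; [assumption|apply exp_pos]. }
  assert (Hdt : exp (c * t) *
     ((- U * (w y t - w x t) + (l3 - U * t - y) *
         (exp (- mu * y) * (rhot y t + K * y * rho y t) -
          exp (- mu * x) * (rhot x t + K * x * rho x t)))
      + c * ((l3 - U * t - y) * (w y t - w x t))) <= 0).
  { apply (is_derive_left_min
      (fun s => exp (c * s) * ((l3 - U * s - y) * (w y s - w x s))) 0 t); [|lra|].
    - apply (is_derive_exp_mult (fun s => c * s)
                (fun s => (l3 - U * s - y) * (w y s - w x s))).
      { auto_derive; [trivial|ring]. }
      assert (Hwy := Hwt y ltac:(lra)). assert (Hwx' := Hwt x ltac:(lra)). auto_derive.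
      + repeat split; eexists; [apply Hwy|apply Hwx'].
      + replace (Derive (fun s => w y s) t) with
          (exp (- mu * y) * (rhot y t + K * y * rho y t))
          by (symmetry; now apply is_derive_unique).
        replace (Derive (fun s => w x s) t) with
          (exp (- mu * x) * (rhot x t + K * x * rho x t))
          by (symmetry; now apply is_derive_unique). ring.
    (* At earlier times the cutoff line lies further to the right, so the pair [(x, y)] stays
       admissible. *)
    - intros s Hs. apply Hmin'; try lra. nra. }
  assert (Hb : - ux x t - mu * u x t + K * x <= - ux y t - mu * u y t + K * y).
  { apply (is_derive_ge0_le (fun z => - ux z t - mu * u z t + K * z)); [lra|].
    intros z Hz. exists (- uxx z t - mu * ux z t + K). split.
    - assert (H1 := gf_ux_x Hfl z t ltac:(lra) ltac:(lra)).
      assert (H2 := gf_u_x Hfl z t ltac:(lra) ltac:(lra)).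
      auto_derive.
      + repeat split; eexists; [apply H1|apply H2].
      + replace (Derive (fun s => ux s t) z) with (uxx z t)
          by (symmetry; now apply is_derive_unique).
        replace (Derive (fun s => u s t) z) with (ux z t)
          by (symmetry; now apply is_derive_unique). ring.
    - specialize (Hux z t ltac:(split; lra)). specialize (Huxx z t ltac:(split; lra)).
      apply Rabs_le_between in Hux, Huxx. unfold K. nra. }
  pose proof (density_nonneg Hfl x t ltac:(lra) ltac:(lra)) as Hrx.
  pose proof (gf_mass Hfl x t ltac:(lra) ltac:(lra)) as Hmx.
  pose proof (gf_mass Hfl y t ltac:(lra) ltac:(lra)) as Hmy.
  assert (Huy := Hu y t ltac:(split; lra)). assert (Huxy := Hux y t ltac:(split; lra)).
  apply Rabs_le_between in Huy, Huxy.
  set (b := fun z => - ux z t - mu * u z t + K * z) in *.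
  change (b x <= b y) in Hb.
  assert (Htx : exp (- mu * x) * (rhot x t + K * x * rho x t) = b x * w x t).
  { assert (rhox x t + - mu * rho x t = 0).
    { apply Rmult_integral in Hdx. pose proof (exp_pos (- mu * x)). lra. }
    replace (rhot x t) with (- (mu * rho x t * u x t + rho x t * ux x t)) by nra.
    unfold b, w; fold mu. ring. }
  assert (Hty : exp (- mu * y) * (rhot y t + K * y * rho y t) =
     - u y t * (exp (- mu * y) * (rhox y t + - mu * rho y t)) + b y * w y t).
  { replace (rhot y t) with (- (rhox y t * u y t + rho y t * ux y t)) by lra.
    unfold b, w; fold mu. ring. }
  rewrite Htx, Hty in Hdt.
  assert (Hwx0 : 0 <= w x t) by (unfold w; pose proof (exp_pos (- (l1 - K * t) * x)); nra).
  assert (Hby : b y <= M1 + l1 * M0 + K).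
  { unfold b. assert (- (mu * u y t) <= l1 * M0) by nra. nra. }
  set (S := exp (- mu * y) * (rhox y t + - mu * rho y t)) in *.
  set (chi := l3 - U * t - y) in *.
  set (Z := w y t - w x t) in *.
  (* By the mass equation [w] satisfies [w_t = - u * w_x + b * w]. The left side splits into
     [(U + u) * - Z], [chi * (b y - b x) * w x] and [(b y + c) * chi * Z]: the first two are
     nonnegative, and the last is positive as a product of two negatives. *)
  assert (Hfin : - (U + u y t) * Z + chi * (b y * w y t - b x * w x t) + c * (chi * Z) <= 0).
  { apply Rmult_le_reg_l with (exp (c * t)); [apply exp_pos|]. rewrite Rmult_0_r.
    eapply Rle_trans; [|exact Hdt]. apply Req_le. f_equal.
    replace (- (U + u y t) * Z) with (- U * Z - u y t * (chi * S))
      by (replace (chi * S) with Z by lra; ring).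
    ring. }
  assert (0 <= (U + u y t) * - Z) by (apply Rmult_le_pos; unfold U; lra).
  assert (0 <= chi * ((b y - b x) * w x t)).
  { apply Rmult_le_pos; [lra|]. apply Rmult_le_pos; lra. }
  assert (0 < - (b y + c) * - (chi * Z)) by (apply Rmult_lt_0_compat; unfold c; lra).
  assert ((b y + c) * (chi * Z) + chi * ((b y - b x) * w x t) =
          chi * (b y * w y t - b x * w x t) + c * (chi * Z)) by (unfold Z; ring).
  lra.
Qed.

(* The barrier [eps (exp (k (x - kappa (tau - t))) - 1)] is nonpositive on
   [t = 0] and on [x = 0], vanishes at [(0, tau)] with positive slope, and is a
   strict subsolution for large [k], uniformly in the degenerate coefficient [rho >= 0]. *)
Lemma no_gas_flow_left (nu gamma T l1 l3 : R) (rho rhox rhot u ux uxx ut : R -> R -> R) :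
  gas_flow nu gamma T rho rhox rhot u ux uxx ut ->
  0 < nu -> 1 < gamma -> 0 < T -> 0 < l1 -> 0 < l3 < 1 ->
  (forall x y, 0 < x <= y -> y < l3 ->
     exp (- l1 * x) * rho x 0 <= exp (- l1 * y) * rho y 0) ->
  (forall x, 0 < x < l3 -> u x 0 <= 0) -> u l3 0 < 0 -> False.
Proof.
  intros Hfl Hnu Hgam HT Hl1 Hl3 Hinit Hu0 Hul3.
  destruct (density_monotone _ _ _ _ _ _ _ _ _ _ _ _ Hfl HT Hl1 Hl3 Hinit)
    as [K [U [HK [HU Hmono]]]].
  destruct (cont_rect_bounded T u) as [M [HM Hu]]; [lra|apply Hfl|].
  destruct (cont_rect_bounded T rho) as [R0 [HR0 Hrho]]; [lra|apply Hfl|].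
  destruct (cont_rect_extend T u) as [G [HG HGu]]; [lra|apply Hfl|].
  set (del := - u l3 0 / 2).
  destruct (gf_u Hfl l3 0) with (eps := del) as [d [Hd Hcont]];
    [split; lra|unfold del; lra|].
  (* The lateral boundary is moved strictly left of [l3]: near [(l3, 0)] the velocity is still below
     half its negative value, and there is room for the cutoff line of the density estimate to
     advance. *)
  set (l := l3 - Rmin (d / 2) (l3 / 2)).
  assert (Hl : 0 < l < l3 /\ l3 - l < d).
  { unfold l. pose proof (Rmin_l (d / 2) (l3 / 2)). pose proof (Rmin_r (d / 2) (l3 / 2)).
    pose proof (Rmin_pos (d / 2) (l3 / 2) ltac:(lra) ltac:(lra)). lra. }
  assert (exists tau, 0 < tau < T /\ tau < d /\ K * tau <= l1 /\ U * tau < l3 - l)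
    as [tau [Htau [Htd [HKtau HUtau]]]].
  { assert (HlK : 0 < l1 / K) by (apply Rdiv_lt_0_compat; lra).
    assert (HlU : 0 < (l3 - l) / (2 * U)) by (apply Rdiv_lt_0_compat; lra).
    (* In order: negativity of [u] at [l], validity of the equations, a nonnegative weight rate, and
       [l] staying left of [l3 - U * t]. *)
    exists (Rmin (Rmin (d / 2) (T / 2)) (Rmin (l1 / K) ((l3 - l) / (2 * U)))).
    set (m := Rmin _ _).
    assert (Hm : 0 < m) by (unfold m; repeat apply Rmin_pos; lra).
    assert (m <= d / 2 /\ m <= T / 2 /\ m <= l1 / K /\ m <= (l3 - l) / (2 * U))
      as [H1 [H2 [H3 H4]]].
    { unfold m; repeat split; unfold Rmin; repeat destruct Rle_dec; lra. }
    apply (Rmult_le_compat_l K) in H3; [|lra].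
    apply (Rmult_le_compat_l U) in H4; [|lra].
    replace (K * (l1 / K)) with l1 in H3 by (field; lra).
    replace (U * ((l3 - l) / (2 * U))) with ((l3 - l) / 2) in H4 by (field; lra).
    lra. }
  assert (Hul : forall s, 0 <= s <= tau -> u l s < - del).
  { intros s Hs. specialize (Hcont l s ltac:(split; lra)).
    assert (Hlt : Rabs (u l s - u l3 0) < del).
    { apply Hcont; [rewrite Rabs_left; lra|rewrite Rabs_pos_eq; lra]. }
    apply Rabs_def2 in Hlt. unfold del in *. lra. }
  assert (Hdel : 0 < del) by (unfold del; lra).
  (* The zero line [x = kap * (tau - t)] of the barrier runs from [(l, 0)] to [(0, tau)]. *)
  set (kap := l / tau).
  assert (Hkap : 0 < kap /\ kap * tau = l).
  { unfold kap; split; [apply Rdiv_lt_0_compat; lra|field; lra]. }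
  destruct Hkap as [Hkap Hkaptau]. clearbody kap.
  assert (exists k, 0 < k /\ R0 * (kap + M) < nu * k) as [k [Hk Hnuk]].
  { assert (0 <= R0 * (kap + M) / nu).
    { apply Rdiv_le_0_compat; [|lra]. apply Rmult_le_pos; lra. }
    exists (R0 * (kap + M) / nu + 1). split; [lra|].
    replace (nu * (R0 * (kap + M) / nu + 1)) with (R0 * (kap + M) + nu) by (field; lra).
    lra. }
  (* On [x = l] the barrier then stays below [del], while [u < - del]. *)
  set (eps := del / exp (k * l)).
  assert (Heps : 0 < eps /\ eps * exp (k * l) = del).
  { pose proof (exp_pos (k * l)).
    unfold eps; split; [apply Rdiv_lt_0_compat; lra|field; lra]. }
  destruct Heps as [Heps Hepsdel]. clearbody eps.
  set (phi := fun x t => exp (k * (x - kap * (tau - t))) - 1).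
  assert (Hexp_le : forall a, a <= 0 -> exp a <= 1).
  { intros a [Ha| ->]; [|rewrite exp_0; lra].
    rewrite <- exp_0. now apply Rlt_le, exp_increasing. }
  assert (Hbarrier : forall x t, 0 <= x <= l -> 0 <= t <= tau ->
            u x t + eps * phi x t <= 0).
  { intros x1 t1 Hx1 Ht1. apply Rnot_lt_le; intros Hpos.
    destruct (continuous_min_attained 0 l tau
      (fun p => - (G (fst (fst p)) (snd p) +
         eps * (exp (k * (fst (fst p) - kap * (tau - snd p))) - 1)))
      (fun _ => 0) ((x1, x1), t1)) as [[[x z] t] [[Hx [_ Ht]] [_ Hmin]]].
    { intros q; solve_continuous. }
    { intros q; solve_continuous. }
    { split; [|split]; simpl; lra. }
    { lra. }
    simpl in Hx, Ht.
    assert (Hmax : forall y s, 0 <= y <= l -> 0 <= s <= tau ->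
              u y s + eps * phi y s <= u x t + eps * phi x t).
    { intros y s Hy Hs. specialize (Hmin ((y, y), s)). simpl in Hmin.
      rewrite !HGu in Hmin by (split; lra). apply Ropp_le_cancel.
      apply Hmin; [split; [|split]; simpl; lra|lra]. }
    clear Hmin.
    assert (Hw : 0 < u x t + eps * phi x t).
    { specialize (Hmax x1 t1 Hx1 Ht1). lra. }
    destruct (gf_bd Hfl t) as [_ [_ [Hb _]]]; [lra|].
    assert (Hphi0 : x <= kap * (tau - t) -> eps * phi x t <= 0).
    { intros H. assert (phi x t <= 0); [|nra]. unfold phi.
      enough (exp (k * (x - kap * (tau - t))) <= 1) by lra. apply Hexp_le. nra. }
    assert (Hx0 : 0 < x).
    { destruct (Req_dec x 0); [|lra]. subst x.
      assert (0 <= kap * (tau - t)) by (apply Rmult_le_pos; lra).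
      specialize (Hphi0 ltac:(lra)). lra. }
    assert (Hxl : x < l).
    { destruct (Req_dec x l); [|lra]. subst x.
      specialize (Hul t Ht).
      assert (exp (k * (l - kap * (tau - t))) <= exp (k * l)).
      { replace (k * (l - kap * (tau - t))) with (k * l + - (k * (kap * (tau - t)))) by ring.
        rewrite exp_plus. pose proof (exp_pos (k * l)).
        assert (exp (- (k * (kap * (tau - t)))) <= 1).
        { apply Hexp_le.
          assert (0 <= k * (kap * (tau - t))); [|lra].
          apply Rmult_le_pos; [lra|]. apply Rmult_le_pos; lra. }
        nra. }
      unfold phi in Hw. nra. }
    assert (Ht0 : 0 < t).
    { destruct (Req_dec t 0); [|lra]. subst t.
      specialize (Hu0 x ltac:(lra)). specialize (Hphi0 ltac:(lra)). lra. }
    set (e := exp (k * (x - kap * (tau - t)))).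
    assert (He : 0 < e) by apply exp_pos.
    assert (Hdt : 0 <= ut x t + eps * (k * kap * e)).
    { enough (- (ut x t + eps * (k * kap * e)) <= 0) by lra.
      apply (is_derive_left_min (fun s => - (u x s + eps * phi x s)) 0 t); [|lra|].
      - assert (H := gf_u_t Hfl x t ltac:(lra) ltac:(lra)).
        unfold phi. auto_derive.
        + repeat split; eexists; apply H.
        + replace (Derive (fun s => u x s) t) with (ut x t)
            by (symmetry; now apply is_derive_unique).
          unfold e, Rminus. ring.
      - intros s Hs. apply Ropp_le_contravar, Hmax; lra. }
    assert (Hderx : forall y, 0 < y < l -> is_derive (fun y => u y t + eps * phi y t) y
        (ux y t + eps * (k * exp (k * (y - kap * (tau - t)))))).
    { intros y Hy.
      assert (H := gf_u_x Hfl y t ltac:(lra) ltac:(lra)).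
      unfold phi. auto_derive.
      + repeat split; eexists; apply H.
      + replace (Derive (fun s => u s t) y) with (ux y t)
          by (symmetry; now apply is_derive_unique).
        unfold Rminus. ring. }
    assert (Hdx : ux x t + eps * (k * e) = 0).
    { enough (- (ux x t + eps * (k * e)) = 0) by lra.
      apply (is_derive_interior_min (fun y => - (u y t + eps * phi y t)) 0 l x); [|lra|].
      - apply (is_derive_opp (V := R_NormedModule)), Hderx; lra.
      - intros y Hy. apply Ropp_le_contravar, Hmax; lra. }
    assert (Hdxx : uxx x t + eps * (k * k * e) <= 0).
    { apply (is_derive_interior_max2 _ _ 0 l x _ Hderx); [|lra|].
      - assert (H := gf_ux_x Hfl x t ltac:(lra) ltac:(lra)).
        auto_derive.
        + repeat split; eexists; apply H.
        + replace (Derive (fun s => ux s t) x) with (uxx x t)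
            by (symmetry; now apply is_derive_unique).
          unfold e, Rminus. ring.
      - intros y Hy. apply Hmax; lra. }
    (* With [a = eps * (k * e)] the conditions at the maximum read [ut >= - a * kap], [ux = - a],
       [uxx <= - a * k]. Together with [px >= 0] they force [nu * k <= rho * (kap + u) <= R0 * (kap
       + M)], against the choice of [k]. *)
    destruct (gf_momentum Hfl x t ltac:(lra) ltac:(lra))
      as [px [Hpx Hmom]].
    assert (HUt : U * t <= U * tau) by (apply Rmult_le_compat_l; lra).
    assert (HKt : K * t <= K * tau) by (apply Rmult_le_compat_l; lra).
    assert (Hpx0 : 0 <= px).
    { apply (is_derive_right_min (fun y => rpow (rho y t) gamma) x l); [assumption|lra|].
      intros y Hy. apply rpow_le; [lra|]. apply Hmono; lra. }
    pose proof (density_nonneg Hfl x t ltac:(lra) ltac:(lra)) as Hr0.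
    assert (HrR := Hrho x t ltac:(split; lra)). assert (HuM := Hu x t ltac:(split; lra)).
    apply Rabs_le_between in HrR, HuM.
    set (a := eps * (k * e)).
    assert (Ha : 0 < a) by (unfold a; repeat apply Rmult_lt_0_compat; lra).
    replace (eps * (k * kap * e)) with (a * kap) in Hdt by (unfold a; ring).
    replace (eps * (k * k * e)) with (a * k) in Hdxx by (unfold a; ring).
    fold a in Hdx. replace (ux x t) with (- a) in Hmom by lra.
    assert (H1 : rho x t * (kap + u x t) <= R0 * (kap + M)).
    { apply Rle_trans with (rho x t * (kap + M)).
      - apply Rmult_le_compat_l; lra.
      - apply Rmult_le_compat_r; lra. }
    assert (H2 : rho x t * - (a * kap) <= rho x t * ut x t)
      by (apply Rmult_le_compat_l; lra).
    assert (H3 : nu * uxx x t <= nu * - (a * k)) by (apply Rmult_le_compat_l; lra).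
    assert (H4 : a * (rho x t * (kap + u x t)) <= a * (R0 * (kap + M)))
      by (apply Rmult_le_compat_l; lra).
    assert (H5 : a * (R0 * (kap + M)) < a * (nu * k))
      by (apply Rmult_lt_compat_l; lra).
    lra. }
  (* At time [tau] the barrier estimate and [exp s >= 1 + s] bound the difference quotients of [u]
     at 0 by [- (eps * k)]; a zero slope tested with tolerance [eps * k] contradicts this. *)
  destruct (gf_slope Hfl tau ltac:(lra)) as [Hslope _].
  destruct (Hslope (eps * k)) as [r [Hr Hlim]]; [apply Rmult_lt_0_compat; lra|].
  set (y := Rmin (r / 2) l).
  assert (Hy : 0 < y <= l /\ y < r).
  { unfold y; split; [split; [apply Rmin_pos; lra|apply Rmin_r]|].
    apply Rle_lt_trans with (r / 2); [apply Rmin_l|lra]. }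
  specialize (Hlim y). simpl in Hlim. unfold Rdist in Hlim.
  rewrite Rminus_0_r, Rabs_pos_eq in Hlim by lra.
  specialize (Hlim ltac:(lra)).
  destruct (gf_bd Hfl tau) as [_ [_ [Hb _]]]; [lra|].
  rewrite Hb, !Rminus_0_r in Hlim. apply Rabs_def2 in Hlim.
  specialize (Hbarrier y tau ltac:(lra) ltac:(lra)). unfold phi in Hbarrier.
  replace (k * (y - kap * (tau - tau))) with (k * y) in Hbarrier by ring.
  pose proof (exp_ineq1_le (k * y)).
  assert (Hle : u y tau <= - (eps * k) * y) by nra.
  assert (u y tau / y <= - (eps * k)).
  { apply (Rmult_le_reg_r y); [lra|].
    replace (u y tau / y * y) with (u y tau) by (field; lra). assumption. }
  lra.
Qed.

(** * Reflection of the interval and reduction of the classical problem to [gas_flow] *)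

Lemma is_derive_reflect (f : R -> R) (x l : R) :
  is_derive f (1 - x) l -> is_derive (fun y => f (1 - y)) x (- l).
Proof.
  intros H. auto_derive.
  - repeat split; now exists l.
  - replace (Derive (fun y => f y) (1 + - x)) with l
      by (symmetry; now apply is_derive_unique). ring.
Qed.

Lemma cont_rect_reflect (T : R) (g : R -> R -> R) :
  cont_rect T g -> cont_rect T (fun x t => g (1 - x) t).
Proof.
  intros Hg x t [Hx Ht] eps Heps.
  destruct (Hg (1 - x) t) with (eps := eps) as [d [Hd H]]; [split; lra|assumption|].
  exists d; split; [assumption|]. intros y s [Hy Hs] Hyx Hst.
  apply H; [split; lra| |assumption].
  replace (1 - y - (1 - x)) with (- (y - x)) by ring. now rewrite Rabs_Ropp.
Qed.

Lemma cont_rect_opp (T : R) (g : R -> R -> R) :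
  cont_rect T g -> cont_rect T (fun x t => - g x t).
Proof.
  intros Hg x t Hxt eps Heps.
  destruct (Hg x t Hxt eps Heps) as [d [Hd H]].
  exists d; split; [assumption|]. intros y s Hys Hyx Hst.
  replace (- g y s - - g x t) with (- (g y s - g x t)) by ring.
  rewrite Rabs_Ropp; auto.
Qed.

Lemma deriv_within_reflect_opp (f : R -> R) (x l : R) :
  deriv_within f 0 1 (1 - x) l -> deriv_within (fun y => - f (1 - y)) 0 1 x l.
Proof.
  intros H eps Heps. destruct (H eps Heps) as [d [Hd Hlim]].
  exists d; split; [assumption|]. intros y [[Hy Hne] Hdist].
  specialize (Hlim (1 - y)). simpl in *. unfold Rdist in *.
  replace (- f (1 - y) - - f (1 - x)) with (- (f (1 - y) - f (1 - x))) by ring.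
  replace (- (f (1 - y) - f (1 - x)) / (y - x)) with
    ((f (1 - y) - f (1 - x)) / (1 - y - (1 - x))) by (field; lra).
  apply Hlim. split; [lra|].
  replace (1 - y - (1 - x)) with (- (y - x)) by ring. now rewrite Rabs_Ropp.
Qed.

(** Under [x -> 1 - x], [u -> - u] the mass equation is unchanged and every term of the momentum
    equation, pressure gradient included, changes sign. *)
Lemma gas_flow_reflect (nu gamma T : R) (rho rhox rhot u ux uxx ut : R -> R -> R) :
  gas_flow nu gamma T rho rhox rhot u ux uxx ut ->
  gas_flow nu gamma T (fun x t => rho (1 - x) t) (fun x t => - rhox (1 - x) t)
    (fun x t => rhot (1 - x) t) (fun x t => - u (1 - x) t) (fun x t => ux (1 - x) t)
    (fun x t => - uxx (1 - x) t) (fun x t => - ut (1 - x) t).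
Proof.
  intros Hfl. constructor.
  - apply cont_rect_reflect, Hfl.
  - apply (cont_rect_opp T (fun x t => u (1 - x) t)), cont_rect_reflect, Hfl.
  - apply cont_rect_reflect, Hfl.
  - apply (cont_rect_opp T (fun x t => uxx (1 - x) t)), cont_rect_reflect, Hfl.
  - intros x t Hx Ht. apply (is_derive_reflect (fun y => rho y t)), Hfl; lra.
  - intros x t Hx Ht. apply Hfl; lra.
  - intros x t Hx Ht. rewrite <- (Ropp_involutive (ux (1 - x) t)).
    apply (is_derive_opp (V := R_NormedModule) (fun y => u (1 - y) t)).
    apply (is_derive_reflect (fun y => u y t)), Hfl; lra.
  - intros x t Hx Ht.
    apply (is_derive_opp (V := R_NormedModule) (fun s => u (1 - x) s)), Hfl; lra.
  - intros x t Hx Ht. apply (is_derive_reflect (fun y => ux y t)), Hfl; lra.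
  - intros x t Hx Ht.
    pose proof (gf_mass Hfl (1 - x) t ltac:(lra) Ht). lra.
  - intros x t Hx Ht.
    destruct (gf_momentum Hfl (1 - x) t ltac:(lra) Ht)
      as [px [Hpx Hm]].
    exists (- px); split; [|lra].
    now apply (is_derive_reflect (fun y => rpow (rho y t) gamma)).
  - intros x Hx. apply (gf_rho_init Hfl); lra.
  - intros t Ht. destruct (gf_bd Hfl t Ht) as [H1 [H2 [H3 H4]]].
    rewrite Rminus_0_r, Rminus_diag. repeat split; lra.
  - intros t Ht. destruct (gf_slope Hfl t Ht) as [H0 H1].
    split; apply (deriv_within_reflect_opp (fun y => u y t)).
    + now rewrite Rminus_0_r.
    + now rewrite Rminus_diag.
Qed.

Arguments gas_flow_reflect {nu gamma T rho rhox rhot u ux uxx ut}.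

(** The derivative of [exp (- c * z) * f z] is [exp (- c * z) * (f' - c * f)], so a lower bound on
    the logarithmic derivative becomes the integrated condition that is propagated in time. *)
Lemma exp_weight_le (f : R -> R) (c b : R) :
  (forall z, 0 < z < b -> 0 < f z /\ exists d, is_derive f z d /\ d / f z >= c) ->
  forall x y, 0 < x <= y -> y < b -> exp (- c * x) * f x <= exp (- c * y) * f y.
Proof.
  intros Hf x y Hx Hy. apply (is_derive_ge0_le (fun z => exp (- c * z) * f z)); [lra|].
  intros z Hz. destruct (Hf z ltac:(lra)) as [Hfz [d [Hd Hdc]]].
  exists (exp (- c * z) * (d + - c * f z)). split.
  - apply (is_derive_exp_mult (fun z => - c * z) f); [auto_derive; [trivial|ring]|assumption].
  - apply Rmult_le_pos; [apply Rlt_le, exp_pos|].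
    apply Rge_le, (Rmult_le_compat_r (f z)) in Hdc; [|lra].
    unfold Rdiv in Hdc; rewrite Rmult_assoc, Rinv_l, Rmult_1_r in Hdc by lra. lra.
Qed.

(** Subtracting [u] times the mass equation turns the conservative momentum equation into the
    nonconservative one. *)
Lemma gas_flow_intro (nu gamma T : R)
  (rho rhox rhoxx rhot u ux uxx ut : R -> R -> R) : 0 < T ->
  C21 T rho rhox rhoxx rhot -> C21 T u ux uxx ut ->
  (forall x t, 0 < x < 1 -> 0 < t <= T ->
     (exists a, deriv_within (fun y => rho y t * u y t) 0 1 x a /\
                rhot x t + a = 0) /\
     (exists b c, deriv_within (fun s => rho x s * u x s) 0 T t b /\
                  deriv_within (fun y => rho y t * (u y t) ^ 2
                                          + rpow (rho y t) gamma) 0 1 x c /\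
                  b + c = nu * uxx x t)) ->
  (forall x, 0 < x < 1 -> 0 <= rho x 0) ->
  (forall t, 0 < t <= T ->
     rho 0 t = 0 /\ u 0 t = 0 /\ ux 0 t = 0 /\
     rho 1 t = 0 /\ u 1 t = 0 /\ ux 1 t = 0) ->
  gas_flow nu gamma T rho rhox rhot u ux uxx ut.
Proof.
  intros HT [Hr [Hr1 [_ [_ HrD]]]] [Hu [Hu1 [Hu2 [_ HuD]]]] Heq Hinit Hbd.
  assert (Hrx : forall x t, 0 < x < 1 -> 0 < t < T ->
            is_derive (fun y => rho y t) x (rhox x t)).
  { intros x t Hx Ht. apply deriv_within_interior with 0 1; [assumption|].
    apply HrD; split; lra. }
  assert (Hrt : forall x t, 0 < x < 1 -> 0 < t < T ->
            is_derive (fun s => rho x s) t (rhot x t)).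
  { intros x t Hx Ht. apply deriv_within_interior with 0 T; [assumption|].
    apply HrD; split; lra. }
  assert (Hux : forall x t, 0 < x < 1 -> 0 < t < T ->
            is_derive (fun y => u y t) x (ux x t)).
  { intros x t Hx Ht. apply deriv_within_interior with 0 1; [assumption|].
    apply HuD; split; lra. }
  assert (Hut : forall x t, 0 < x < 1 -> 0 < t < T ->
            is_derive (fun s => u x s) t (ut x t)).
  { intros x t Hx Ht. apply deriv_within_interior with 0 T; [assumption|].
    apply HuD; split; lra. }
  assert (Hmass : forall x t, 0 < x < 1 -> 0 < t < T ->
            rhot x t + (rhox x t * u x t + rho x t * ux x t) = 0).
  { intros x t Hx Ht. destruct (Heq x t Hx ltac:(lra)) as [[a [Ha Hma]] _].
    apply deriv_within_interior in Ha; [|assumption].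
    assert (Ha' := is_derive_mult _ _ _ _ _ (Hrx x t Hx Ht) (Hux x t Hx Ht) Rmult_comm).
    apply is_derive_unique in Ha. apply is_derive_unique in Ha'.
    unfold mult, plus in Ha'; simpl in Ha'. rewrite Ha in Ha'. lra. }
  constructor; auto.
  - intros x t Hx Ht. apply deriv_within_interior with 0 1; [assumption|].
    apply HuD; split; lra.
  - intros x t Hx Ht. destruct (Heq x t Hx ltac:(lra)) as [_ [b [c [Hb [Hc Hbc]]]]].
    specialize (Hmass x t Hx Ht).
    apply deriv_within_interior in Hb; [|assumption].
    apply deriv_within_interior in Hc; [|assumption].
    assert (Hb' := is_derive_mult _ _ _ _ _ (Hrt x t Hx Ht) (Hut x t Hx Ht) Rmult_comm).
    apply is_derive_unique in Hb. apply is_derive_unique in Hb'.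
    unfold mult, plus in Hb'; simpl in Hb'. rewrite Hb in Hb'.
    (* The pressure is differentiated as the total flux minus [rho * u ^ 2], which avoids the chain
       rule for [rpow] at vacuum. *)
    set (q := rhox x t * u x t ^ 2 + rho x t * (2 * u x t * ux x t)).
    assert (Hq : is_derive (fun y => rho y t * (u y t) ^ 2) x q).
    { assert (H1 := Hrx x t Hx Ht). assert (H2 := Hux x t Hx Ht). auto_derive.
      - repeat split; eexists; [apply H1|apply H2].
      - replace (Derive (fun s => rho s t) x) with (rhox x t)
          by (symmetry; now apply is_derive_unique).
        replace (Derive (fun s => u s t) x) with (ux x t)
          by (symmetry; now apply is_derive_unique). unfold q. ring. }
    exists (c - q). split.
    + apply is_derive_ext with
        (fun y => (rho y t * (u y t) ^ 2 + rpow (rho y t) gamma) - rho y t * (u y t) ^ 2).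
      { intros y. simpl. ring. }
      apply (is_derive_minus (V := R_NormedModule) _ _ _ _ _ Hc Hq).
    + rewrite <- Hbc, Hb'.
      replace (rhot x t) with (- (rhox x t * u x t + rho x t * ux x t)) by lra.
      unfold q. ring.
  - intros t Ht. destruct (Req_dec t 0) as [->|Hne].
    + repeat split; apply (cont_rect_time_limit T); auto; try lra;
        intros s Hs; apply Hbd; lra.
    + destruct (Hbd t ltac:(lra)) as [H1 [H2 [_ [H4 [H5 _]]]]]. auto.
  - intros t Ht. destruct (Hbd t ltac:(lra)) as [_ [_ [H3 [_ [_ H6]]]]]. split.
    + destruct (HuD 0 t ltac:(split; lra)) as [H _]. now rewrite H3 in H.
    + destruct (HuD 1 t ltac:(split; lra)) as [H _]. now rewrite H6 in H.
Qed.

Theorem theorem2p1 (nu gamma : R) (rho0 u0 : R -> R)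
  (Hnu : 0 < nu) (Hgamma : 1 < gamma)
  (Hrho0c : forall x, 0 <= x <= 1 -> cont_within rho0 0 1 x)
  (Hrho0pos : forall x, 0 < x < 1 -> 0 < rho0 x)
  (Hrho0bd : rho0 0 = 0 /\ rho0 1 = 0)
  (Hu0c : forall x, 0 <= x <= 1 -> cont_within u0 0 1 x)
  (Hcond : exists l1 l2 l3 l4 : R,
      0 < l1 /\ 0 < l2 /\ 0 < l3 < 1 /\ 0 < l4 < 1 /\
      ( ( (forall x, 0 < x < l3 ->
             exists d, derivable_pt_lim rho0 x d /\ d / rho0 x >= l1)
          /\ u0 l3 < 0 /\ (forall x, 0 < x < l3 -> u0 x <= 0) )
        \/
        ( (forall x, l4 < x < 1 ->
             exists d, derivable_pt_lim rho0 x d /\ d / rho0 x <= - l2)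
          /\ u0 l4 > 0 /\ (forall x, l4 < x < 1 -> u0 x >= 0) ) )) :
  forall T : R, 0 < T ->
  ~ exists (rho rhox rhoxx rhot u ux uxx ut : R -> R -> R),
      C21 T rho rhox rhoxx rhot /\ C21 T u ux uxx ut /\
      (* equations in I x (0,T] *)
      (forall x t, 0 < x < 1 -> 0 < t <= T ->
         (exists a, deriv_within (fun y => rho y t * u y t) 0 1 x a /\
                    rhot x t + a = 0) /\
         (exists b c, deriv_within (fun s => rho x s * u x s) 0 T t b /\
                      deriv_within (fun y => rho y t * (u y t) ^ 2
                                              + rpow (rho y t) gamma) 0 1 x c /\
                      b + c = nu * uxx x t)) /\
      (* initial data on I x {t = 0} *)
      (forall x, 0 < x < 1 -> rho x 0 = rho0 x /\ u x 0 = u0 x) /\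
      (* boundary data on dI x (0,T] *)
      (forall t, 0 < t <= T ->
         rho 0 t = 0 /\ u 0 t = 0 /\ ux 0 t = 0 /\
         rho 1 t = 0 /\ u 1 t = 0 /\ ux 1 t = 0).
Proof.
  intros T HT [rho [rhox [rhoxx [rhot [u [ux [uxx [ut [Hrho [Hu [Heq [Hinit Hbd]]]]]]]]]]]].
  assert (Hfl : gas_flow nu gamma T rho rhox rhot u ux uxx ut).
  { apply gas_flow_intro with rhoxx; auto.
    intros x Hx. rewrite (proj1 (Hinit x Hx)). now apply Rlt_le, Hrho0pos. }
  destruct Hcond as [l1 [l2 [l3 [l4 [Hl1 [Hl2 [Hl3 [Hl4
    [[Hd [Hul Hu0]]|[Hd [Hul Hu0]]]]]]]]]]].
  - apply (no_gas_flow_left _ _ _ l1 l3 _ _ _ _ _ _ _ Hfl); auto.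
    + intros x y Hx Hy.
      rewrite (proj1 (Hinit x ltac:(lra))), (proj1 (Hinit y ltac:(lra))).
      apply exp_weight_le with l3; auto. intros z Hz.
      split; [apply Hrho0pos; lra|].
      destruct (Hd z Hz) as [d [Hder Hdl]]. exists d.
      split; [now apply is_derive_Reals|assumption].
    + intros x Hx. rewrite (proj2 (Hinit x ltac:(lra))). auto.
    + now rewrite (proj2 (Hinit l3 Hl3)).
  (* Reflection sends [(l4, 1)] to [(0, 1 - l4)] and flips the signs of the logarithmic slope and of
     the velocity, giving the left alternative with rate [l2]. *)
  - apply (no_gas_flow_left _ _ _ l2 (1 - l4) _ _ _ _ _ _ _ (gas_flow_reflect Hfl));
      auto; try lra.
    + intros x y Hx Hy.
      rewrite (proj1 (Hinit (1 - x) ltac:(lra))), (proj1 (Hinit (1 - y) ltac:(lra))).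
      apply (exp_weight_le (fun z => rho0 (1 - z))) with (1 - l4); auto. intros z Hz.
      assert (Hpos : 0 < rho0 (1 - z)) by (apply Hrho0pos; lra).
      split; [assumption|].
      destruct (Hd (1 - z) ltac:(lra)) as [d [Hder Hdl]]. exists (- d).
      split; [now apply is_derive_reflect, is_derive_Reals|].
      unfold Rdiv in *. rewrite Ropp_mult_distr_l_reverse. lra.
    + intros x Hx. rewrite (proj2 (Hinit (1 - x) ltac:(lra))).
      specialize (Hu0 (1 - x) ltac:(lra)). lra.
    + replace (1 - (1 - l4)) with l4 by ring. rewrite (proj2 (Hinit l4 Hl4)). lra.
Qed.
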